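(* Assume that the formula $\phi(x;y)$ is NIP and $\phi(x;b)\in L(\mathcal U)$ does not divide over $M$. Let $q$ be a coheir of $\mathrm{tp}(b/M)$. Then for some $a\in \mathcal U$, $q\vdash \phi(a;y)$.
   Context: $T$ is a complete theory (not assumed NIP) in a language $L$, $\mathcal U$ is a monster model and $M$ is a model. A coheir of $\mathrm{tp}(b/M)$ means a global type extending $\mathrm{tp}(b/M)$ which is finitely satisfiable in $M$. A formula $\phi(x;b)$ divides over $M$ if there is an $M$-indiscernible sequence $(b_i:i<\omega)$ with $b_0=b$ such that $\{\phi(x;b_i):i<\omega\}$ is inconsistent. *)

(* Defs.v *)
From mathcomp Require Import all_boot.
From mathcomp Require Import boolp classical_sets functions cardinality.

Set Implicit Arguments.
Unset Strict Implicit.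
Unset Printing Implicit Defensive.

Local Open Scope classical_set_scope.
Local Open Scope card_scope.

(** Constants are function symbols of arity 0. *)
Record language := Language {
  fsym : Type;
  rsym : Type;
  far : fsym -> nat;
  rar : rsym -> nat
}.

Inductive term (L : language) (V : Type) : Type :=
| Var of V
| App (f : fsym L) of ('I_(far f) -> term L V).

(** [formula L V] is the type of [L]-formulas whose free variables are
    labelled by [V].  In the body of [All], the label [None] is the newly bound
    variable.  The other connectives are classically definable. *)
Inductive formula (L : language) (V : Type) : Type :=
| Eq of term L V & term L V
| Rel (r : rsym L) of ('I_(rar r) -> term L V)
| Bot
| Imp of formula L V & formula L V
| All of formula L (option V).

Arguments Bot {L V}.

Definition Not (L : language) (V : Type) (phi : formula L V) : formula L V :=
  Imp phi Bot.

Fixpoint tmap (L : language) (V W : Type) (h : V -> W) (t : term L V) :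
    term L W :=
  match t with
  | Var x => Var L (h x)
  | App f ts => App (fun i => tmap h (ts i))
  end.

Fixpoint fmap (L : language) (V W : Type) (h : V -> W) (phi : formula L V) :
    formula L W :=
  match phi with
  | Eq t u => Eq (tmap h t) (tmap h u)
  | Rel r ts => Rel (fun i => tmap h (ts i))
  | Bot => Bot
  | Imp p1 p2 => Imp (fmap h p1) (fmap h p2)
  | All p => All (fmap (omap h) p)
  end.

Record structure (L : language) := Structure {
  carrier :> Type;
  carrier_inhabited : inhabited carrier;
  finterp : forall f : fsym L, ('I_(far f) -> carrier) -> carrier;
  rinterp : forall r : rsym L, ('I_(rar r) -> carrier) -> Prop
}.

Fixpoint teval (L : language) (U : structure L) (V : Type) (v : V -> U)
    (t : term L V) : U :=
  match t with
  | Var x => v x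
  | App f ts => finterp (fun i => teval v (ts i))
  end.

Definition vcons (U V : Type) (u : U) (v : V -> U) : option V -> U :=
  fun o => if o is Some x then v x else u.

Fixpoint sat (L : language) (U : structure L) (V : Type) (v : V -> U)
    (phi : formula L V) : Prop :=
  match phi with
  | Eq t u => teval v t = teval v u
  | Rel r ts => rinterp (fun i => teval v (ts i))
  | Bot => False
  | Imp p1 p2 => sat v p1 -> sat v p2
  | All p => forall u : U, sat (vcons u v) p
  end.

Definition sentence (L : language) : Type := formula L 'I_0.

Definition truein (L : language) (U : structure L) (s : sentence L) : Prop :=
  forall v : 'I_0 -> U, sat v s.

Definition model (L : language) (T : set (sentence L)) (U : structure L) :
    Prop :=
  forall s, T s -> truein U s.

Definition complete_theory (L : language) (T : set (sentence L)) : Prop :=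
  (exists N : structure L, model T N) /\
  forall s : sentence L,
    (forall N : structure L, model T N -> truein N s) \/
    (forall N : structure L, model T N -> truein N (Not s)).

Definition card_lt (T1 T2 : Type) (A : set T1) (B : set T2) : Prop :=
  (A #<= B) /\ ~ (B #<= A).

Section Elementarity.
Variables (L : language) (U : structure L).

Definition fclosed (A : set U) : Prop :=
  forall (f : fsym L) (v : 'I_(far f) -> U),
    (forall i, A (v i)) -> A (finterp v).

Definition substructure (A : set U) (Ane : inhabited {u : U | A u})
    (Acl : fclosed A) : structure L :=
  @Structure L {u : U | A u} Ane
    (fun f v => exist A (finterp (fun i => proj1_sig (v i)))
                  (Acl f _ (fun i => proj2_sig (v i))))
    (fun r v => rinterp (fun i => proj1_sig (v i))).

Definition elementary_substructure (A : set U) : Prop :=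
  exists (Ane : inhabited {u : U | A u}) (Acl : fclosed A),
  forall (k : nat) (phi : formula L 'I_k) (v : 'I_k -> {u : U | A u}),
    @sat L (substructure Ane Acl) 'I_k v phi <->
    sat (fun i => proj1_sig (v i)) phi.

Definition automorphism (s : U -> U) : Prop :=
  [/\ bijective s,
      forall (f : fsym L) (v : 'I_(far f) -> U),
        s (finterp v) = finterp (fun i => s (v i))
    & forall (r : rsym L) (v : 'I_(rar r) -> U),
        rinterp (fun i => s (v i)) <-> rinterp v].

Definition elementary_map (A : set U) (g : U -> U) : Prop :=
  forall (k : nat) (phi : formula L 'I_k) (v : 'I_k -> U),
    (forall i, A (v i)) -> (sat v phi <-> sat (fun i => g (v i)) phi).

End Elementarity.

(** [pformula U V] is the set of [L(U)]-formulas in the free variables [V]: a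
    free label is either a variable [inl x] or a parameter [inr u]. *)
Definition pformula (L : language) (U : structure L) (V : Type) : Type :=
  formula L (V + U).

Section Types.
Variables (L : language) (U : structure L) (V : Type).
Implicit Types (A : set U) (p : set (pformula U V)) (v : V -> U).

Definition psat v (psi : pformula U V) : Prop :=
  sat (fun z : V + U => match z with inl x => v x | inr u => u end) psi.

Definition over A : set (pformula U V) :=
  range (fmap (fun z : V + {u : U | A u} =>
           match z with inl x => inl x | inr c => inr (proj1_sig c) end)
         : formula L (V + {u : U | A u}) -> pformula U V).

Definition finsat A p : Prop :=
  forall (k : nat) (psi : 'I_k -> pformula U V), (forall i, p (psi i)) ->
    exists v : V -> U, (forall x, A (v x)) /\ forall i, psat v (psi i).

(** Consistency is understood modulo the elementary diagram of [U]. *)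
Definition consistent p : Prop := finsat setT p.

Definition complete_type A p : Prop :=
  [/\ p `<=` over A,
      consistent p
    & forall psi, over A psi -> p psi \/ p (Not psi)].

Definition tp A v : set (pformula U V) :=
  [set psi | over A psi /\ psat v psi].

(** [p |- psi], modulo the elementary diagram of [U]. *)
Definition proves p (psi : pformula U V) : Prop :=
  exists (k : nat) (th : 'I_k -> pformula U V),
    (forall i, p (th i)) /\
    forall v, (forall i, psat v (th i)) -> psat v psi.

Definition coheir A v p : Prop :=
  [/\ complete_type setT p, tp A v `<=` p & finsat A p].

End Types.

(** The cardinal kappa is given as (the cardinality of) a type [K]. *)
Definition saturated (L : language) (K : Type) (U : structure L) : Prop :=
  forall A : set U, card_lt A [set: K] ->
  forall (k : nat) (p : set (pformula U 'I_k)), complete_type A p ->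
    exists v : 'I_k -> U, forall psi, p psi -> psat v psi.

Definition strongly_homogeneous (L : language) (K : Type) (U : structure L) :
    Prop :=
  forall A : set U, card_lt A [set: K] ->
  forall g : U -> U, elementary_map A g ->
    exists s : U -> U, automorphism s /\ forall u, A u -> s u = g u.

(** [formula L nat] has cardinality [|L| + aleph_0], so that kappa is
    uncountable and larger than [|T|]. *)
Definition monster (L : language) (T : set (sentence L)) (K : Type)
    (U : structure L) : Prop :=
  [/\ model T U,
      card_lt [set: formula L nat] [set: K],
      saturated K U
    & strongly_homogeneous K U].

Section Dividing.
Variables (L : language) (U : structure L) (m n : nat).

(** Partitioned formulas phi(x;y): [x] is labelled by ['I_m], [y] by ['I_n]. *)
Implicit Type phi : formula L ('I_m + 'I_n).

Definition sat2 phi (a : 'I_m -> U) (b : 'I_n -> U) : Prop :=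
  sat (fun z : 'I_m + 'I_n => match z with inl i => a i | inr j => b j end) phi.

(** phi(x;b) *)
Definition instr phi (b : 'I_n -> U) : pformula U 'I_m :=
  fmap (fun z : 'I_m + 'I_n =>
          match z with inl i => inl i | inr j => inr (b j) end) phi.

(** phi(a;y) *)
Definition instl phi (a : 'I_m -> U) : pformula U 'I_n :=
  fmap (fun z : 'I_m + 'I_n =>
          match z with inl i => inr (a i) | inr j => inl j end) phi.

(** No infinite set of [x]-tuples is shattered by phi(x;y). *)
Definition NIP phi : Prop :=
  ~ exists (a : nat -> 'I_m -> U) (b : set nat -> 'I_n -> U),
      forall (i : nat) (I : set nat), sat2 phi (a i) (b I) <-> I i.

Definition indiscernible (A : set U) (bs : nat -> 'I_n -> U) : Prop :=
  forall (k : nat) (I J : 'I_k -> nat),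
    {homo I : i j / (i < j)%N} -> {homo J : i j / (i < j)%N} ->
    tp A (fun ij : 'I_k * 'I_n => bs (I ij.1) ij.2) =
    tp A (fun ij : 'I_k * 'I_n => bs (J ij.1) ij.2).

Definition divides (A : set U) phi (b : 'I_n -> U) : Prop :=
  exists bs : nat -> 'I_n -> U,
    [/\ indiscernible A bs, bs 0%N = b
      & ~ consistent (range (fun i => instr phi (bs i)))].

End Dividing.

(* Main.v *)
From mathcomp Require Import all_boot.
From mathcomp Require Import boolp classical_sets functions cardinality filter.
Require Import Defs.

Set Implicit Arguments.
Unset Strict Implicit.
Unset Printing Implicit Defensive.

Local Open Scope classical_set_scope.
Local Open Scope card_scope.

(** Suppose [phi(a;y)] belongs to [q] for no [a].  As [q] is finitely satisfiable
    in [M], it is induced by an ultrafilter [D] on the tuples of [M].  A Morley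
    sequence [(b_i)] of [q] over [M] starting at [b] is [M]-indiscernible, and a
    formula over [M] holds of [b_0, ..., b_(k-1)] iff it holds of
    [t_0, ..., t_(k-1)] for [D]-most [t_(k-1)], ..., [D]-most [t_0].  Since
    [phi(x;b)] does not divide, [{phi(x;b_i)}] is consistent, so for generic [t]
    and any set [w] of indices one can choose [a = g(t)], depending only on the
    [t_i] with [i] in [w], such that [phi(a;t_i)] for these [i].  For [i] outside
    [w] the tuple [t_i] generically avoids [phi(g(t);y)]: otherwise the limit of
    these sets along [D] would be [D]-large, while by saturation it is contained
    in some [phi(a;y)].  So every [w] is cut out on [(b_i)] by an instance of
    [phi], contradicting NIP. *)

(** * Cardinalities *)

(** Hilbert's hotel: an infinite [A] contains an injective sequence [h], and moving [h i] to
    [h i.*2] frees the odd places for the points of [F] outside [A]. *)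
Lemma card_setU_countable_le (T : Type) (A F : set T) :
  infinite_set A -> countable F -> A `|` F #<= A.
Proof.
move=> /infiniteP/card_leP[g] /countable_injP[c cinj].
pose h (i : nat) : T := set_val (g (SigSub (mem_set (I : [set: nat] i)))).
have hA i : A (h i) by apply: set_mem; rewrite /h; exact: valP.
have hinj : injective h.
  move=> i j /val_inj /(@inj _ _ _ g).
  by rewrite !inE => /(_ I I) [].
have hdbl i j : h i.*2 = h j.*2 -> i = j by move=> /hinj/double_inj.
pose f (u : T) : T :=
  match pselect (exists i, h i = u) with
  | left e => h (sval (cid e)).*2
  | right _ => if pselect (A u) then u else h (c u).*2.+1
  end.
have finj : {in A `|` F &, injective f}.
  move=> u v /set_mem uAF /set_mem vAF; rewrite /f.
  case: (pselect (exists i, h i = u)) => [eu|nu];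
    case: (pselect (exists i, h i = v)) => [ev|nv].
  - by case: (cid eu) (cid ev) => [i hi] [j hj] /= /hdbl ij; rewrite -hi -hj ij.
  - case: (pselect (A v)) => [Av|nAv].
      by move=> E; case: nv; eexists; exact: E.
    by move=> E; have /(congr1 odd) := hinj _ _ E; rewrite /= !odd_double.
  - case: (pselect (A u)) => [Au|nAu].
      by move=> E; case: nu; eexists; exact: esym E.
    by move=> E; have /(congr1 odd) := hinj _ _ E; rewrite /= !odd_double.
  - case: (pselect (A u)) => [Au|nAu]; case: (pselect (A v)) => [Av|nAv] //.
    + by move=> E; case: nu; eexists; exact: esym E.
    + by move=> E; case: nv; eexists; exact: E.
    + case: uAF vAF => [//|Fu] [//|Fv] /hinj [] /double_inj.
      by apply: cinj; exact: mem_set.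
apply: (@card_le_trans _ _ _ (f @` (A `|` F))).
  by have := inj_card_eq finj; rewrite card_eq_sym => /card_eqPle[].
apply: subset_card_le => _ [u _ <-]; rewrite /f.
case: (pselect (exists i, h i = u)) => [e|_]; first exact: hA.
by case: (pselect (A u)) => [Au|nAu] //=; exact: hA.
Qed.

Lemma card_lt_countable (T K : Type) (A : set T) :
  card_lt [set: nat] [set: K] -> countable A -> card_lt A [set: K].
Proof.
move=> [leK nleK] cA; split; first exact: card_le_trans cA leK.
by move=> KA; apply: nleK; exact: card_le_trans KA cA.
Qed.

Lemma card_lt_setU (T K : Type) (A F : set T) :
  card_lt [set: nat] [set: K] -> card_lt A [set: K] -> countable F ->
  card_lt (A `|` F) [set: K].
Proof.
move=> ltK [leA nleA] cF; have [finA|infA] := pselect (finite_set A).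
  apply: card_lt_countable => //.
  rewrite -bigcup2E; apply: bigcup_countable => // i _.
  case: i => [|[|i]] //=; exact: finite_set_countable.
have AF := card_setU_countable_le infA cF; split.
  exact: card_le_trans AF leA.
by move=> KA; apply: nleA; exact: card_le_trans KA AF.
Qed.

(** * Ultrafilters *)

Lemma ultrafilter_extending (T : Type) (B : set (set T)) :
  (forall k (S : 'I_k -> set T), (forall i, B (S i)) ->
     exists x, forall i, S i x) ->
  exists D : set_system T, UltraFilter D /\ B `<=` D.
Proof.
move=> fip.
pose F : set_system T := [set S | exists k (R : 'I_k -> set T),
  (forall i, B (R i)) /\ forall x, (forall i, R i x) -> S x].
suff /ultraFilterLemma[D [uD FD]] : ProperFilter F.
  exists D; split=> // S BS; apply: FD; exists 1, (fun=> S).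
  by split=> // x /(_ ord0).
apply: Build_ProperFilter_ex => [S [k [R [BR RS]]]|].
  by have [x /RS] := fip _ _ BR; exists x.
split.
- by exists 0, (fun=> setT); split=> // -[].
- move=> S1 S2 [k1 [R1 [BR1 RS1]]] [k2 [R2 [BR2 RS2]]].
  exists (k1 + k2)%N.
  exists (fun i => match fintype.split i with inl j => R1 j | inr j => R2 j end).
  split=> [i|x Rx]; first by case: (fintype.split i).
  split; [apply: RS1 => j|apply: RS2 => j].
    by have := Rx (lshift k2 j); rewrite (unsplitK (inl j)).
  by have := Rx (rshift k1 j); rewrite (unsplitK (inr j)).
- move=> S1 S2 S12 [k [R [BR RS]]]; exists k, R; split=> // x Rx.
  exact/S12/RS.
Qed.

Lemma ultraC (T : Type) (D : set_system T) (A : set T) :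
  UltraFilter D -> ~ D A <-> D (~` A).
Proof.
move=> uD; split=> [nDA|DnA DA]; first by have [] := in_ultra_setVsetC A uD.
by apply: (filter_not_empty D); rewrite -(setICr A); exact: filterI.
Qed.

(** * Syntax *)

Lemma tmap_comp (L : language) (V W X : Type) (g : W -> X) (h : V -> W)
    (t : term L V) : tmap g (tmap h t) = tmap (g \o h) t.
Proof. by elim: t => //= f ts IH; congr App; apply/funext. Qed.

Lemma fmap_comp (L : language) (V W X : Type) (g : W -> X) (h : V -> W)
    (psi : formula L V) : fmap g (fmap h psi) = fmap (g \o h) psi.
Proof.
elim: psi W X g h => //= {V}.
- by move=> V t u W X g h; rewrite !tmap_comp.
- by move=> V r ts W X g h; congr Rel; apply/funext => i; rewrite tmap_comp.
- by move=> V p IHp p' IHp' W X g h; rewrite IHp IHp'.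
- move=> V p IHp W X g h; rewrite IHp; congr (All (fmap _ _)).
  by apply/funext => -[].
Qed.

Lemma tmap_id (L : language) (V : Type) (t : term L V) : tmap id t = t.
Proof. by elim: t => //= f ts IH; congr App; apply/funext. Qed.

Lemma fmap_id (L : language) (V : Type) (psi : formula L V) :
  fmap id psi = psi.
Proof.
elim: psi => //= {V}.
- by move=> V t u; rewrite !tmap_id.
- by move=> V r ts; congr Rel; apply/funext => i; rewrite tmap_id.
- by move=> V p -> p' ->.
- move=> V p IHp; rewrite -[in RHS]IHp; congr (All (fmap _ _)).
  by apply/funext => -[].
Qed.

(** * Satisfaction under renaming and definable predicates *)

Section Semantics.
Variables (L : language) (U : structure L).

Lemma teval_tmap (V W : Type) (h : V -> W) (v : W -> U) (t : term L V) :
  teval v (tmap h t) = teval (v \o h) t.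
Proof. by elim: t => //= f ts IH; congr finterp; apply/funext. Qed.

Lemma sat_fmap (V W : Type) (h : V -> W) (v : W -> U) (psi : formula L V) :
  sat v (fmap h psi) = sat (v \o h) psi.
Proof.
elim: psi W h v => //= {V}.
- by move=> V t u W h v; rewrite !teval_tmap.
- move=> V r ts W h v; congr rinterp; apply/funext => i.
  by rewrite teval_tmap.
- by move=> V p IHp p' IHp' W h v; rewrite IHp IHp'.
- move=> V p IHp W h v; apply: eq_forall => u; rewrite IHp.
  by congr (sat _ p); apply/funext => -[].
Qed.

(** There are no parameters: an element enters only as the value of a variable in [V]. Reasoning
    with predicates avoids writing formulas out. *)
Definition definable (V : Type) (P : (V -> U) -> Prop) : Prop :=
  exists psi : formula L V, forall v, sat v psi <-> P v.

Lemma definable_imp (V : Type) (P Q : (V -> U) -> Prop) :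
  definable P -> definable Q -> definable (fun v => P v -> Q v).
Proof.
move=> [p pP] [q qQ]; exists (Imp p q) => v /=.
by split=> PQ /pP/PQ/qQ.
Qed.

Lemma definable_not (V : Type) (P : (V -> U) -> Prop) :
  definable P -> definable (fun v => ~ P v).
Proof. by move=> dP; apply: definable_imp dP _; exists Bot. Qed.

Lemma definable_ext (V : Type) (P Q : (V -> U) -> Prop) :
  (forall v, P v <-> Q v) -> definable P -> definable Q.
Proof. by move=> PQ [p pP]; exists p => v; rewrite pP. Qed.

Lemma definable_and (V : Type) (P Q : (V -> U) -> Prop) :
  definable P -> definable Q -> definable (fun v => P v /\ Q v).
Proof.
move=> dP dQ.
apply: definable_ext (definable_not (definable_imp dP (definable_not dQ))) => v.
by split=> [/not_implyP[Pv /contrapT Qv]//|[Pv Qv] PnQ]; exact: PnQ Pv Qv.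
Qed.

Lemma definable_sat_fmap (V W : Type) (h : V -> W) (psi : formula L V) :
  definable (fun v : W -> U => sat (v \o h) psi).
Proof. by exists (fmap h psi) => v; rewrite sat_fmap. Qed.

Lemma definable_forall_lt (V : Type) (N : nat) (P : nat -> (V -> U) -> Prop) :
  (forall i, definable (P i)) ->
  definable (fun v => forall i, (i < N)%N -> P i v).
Proof.
move=> dP; elim: N => [|N IH]; first by exists (Not Bot) => v; split=> // _ [].
apply: definable_ext (definable_and IH (dP N)) => v; split.
  by move=> [PN PvN] i; rewrite ltnS leq_eqVlt => /predU1P[->|/PN].
by move=> PN; split=> [i iN|]; apply: PN => //; exact: ltnW.
Qed.

Definition vjoin (V W : Type) (a : V -> U) (v : W -> U) (z : V + W) : U :=
  match z with inl i => a i | inr w => v w end.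

Lemma definable_forall_tuple (m : nat) (V : Type)
    (P : ('I_m + V -> U) -> Prop) :
  definable P -> definable (fun v => forall a : 'I_m -> U, P (vjoin a v)).
Proof.
elim: m V P => [|m IH] V P [p pP].
  pose r (z : 'I_0 + V) : V := match z with
    | inl i => False_rect V (notF (ltn_ord i)) | inr w => w end.
  apply: definable_ext (definable_sat_fmap r p) => v.
  have vr a : v \o r = vjoin a v by apply/funext => -[[]|].
  split=> [satp a|Pv]; first by rewrite -vr; exact/pP.
  by apply/pP; rewrite (vr (fun i => v (r (inl i)))).
(* Coordinate [ord0] becomes the variable [None], later bound by [All]; the induction hypothesis
   quantifies the remaining [m] coordinates. *)
pose r (z : 'I_m.+1 + V) : 'I_m + option V := match z with
  | inl i => if unlift ord0 i is Some j then inl j else inr None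
  | inr w => inr (Some w) end.
have [psi psiP] := IH _ _ (definable_sat_fmap r p).
exists (All psi) => v /=; split=> [satp a|Pv u].
  have /psiP/(_ (a \o lift ord0)) := satp (a ord0).
  move/pP; congr P; apply/funext => -[i|w] //=.
  by case: unliftP => [j|] ->.
apply/psiP => a; apply/pP.
have := Pv (fun i => if unlift ord0 i is Some j then a j else u).
by congr P; apply/funext => -[i|w] //=; case: unliftP.
Qed.

End Semantics.

(** * Types and saturation *)

Section OverParams.
Variables (L : language) (U : structure L).

Lemma over_fmap (V W : Type) (A : set U) (h : V -> W + U)
    (psi : formula L V) :
  (forall z, if h z is inr u then A u else True) -> over A (fmap h psi).
Proof.
move=> hA.
pose emb (z : W + {u : U | A u}) : W + U :=
  match z with inl x => inl x | inr c => inr (proj1_sig c) end.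
have /choice[h' h'E] : forall z, exists z', emb z' = h z.
  move=> z; move: (hA z); case: (h z) => [x _|u Au]; first by exists (inl x).
  by exists (inr (exist _ u Au)).
exists (fmap h' psi) => //; rewrite fmap_comp; congr fmap.
by apply/funext => z; exact: h'E.
Qed.

Lemma over_sub (V : Type) (A B : set U) (psi : pformula U V) :
  A `<=` B -> over A psi -> over B psi.
Proof.
by move=> AB [p _ <-]; apply: over_fmap => -[x|[u Au]] //; exact: AB.
Qed.

Lemma over_setT (V : Type) (psi : pformula U V) : over setT psi.
Proof. by rewrite -[psi]fmap_id; apply: over_fmap => -[]. Qed.

Lemma over_not (V : Type) (A : set U) (psi : pformula U V) :
  over A psi -> over A (Not psi).
Proof. by move=> [p _ <-]; exists (Not p). Qed.

(** [saturated] speaks of complete types only. An ultrafilter containing the solution sets of [p]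
    yields a completion: the formulas over [A] whose solution set is large. *)
Lemma saturated_realizes (K : Type) (A : set U) (k : nat)
    (p : set (pformula U 'I_k)) :
  saturated K U -> card_lt A [set: K] -> p `<=` over A -> consistent p ->
  exists v : 'I_k -> U, forall psi, p psi -> psat v psi.
Proof.
move=> satU ltA pA pcons.
pose mods (psi : pformula U 'I_k) : set ('I_k -> U) := [set v | psat v psi].
have [|D [uD pD]] := @ultrafilter_extending _ (mods @` p).
  move=> j S SP; have /choice[psi psiP] : forall i, exists f, p f /\ mods f = S i.
    by move=> i; have [f] := SP i; exists f.
  have [v [_ vpsi]] := pcons _ psi (fun i => (psiP i).1).
  by exists v => i; rewrite -(psiP i).2; exact: vpsi.
have [|v vP] := satU A ltA k [set psi | over A psi /\ D (mods psi)].
  split=> [psi []//|j psi psiD|psi Apsi].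
    have Dpsi : D [set v | forall i, mods (psi i) v].
      by apply: filter_forall => i; exact: (psiD i).2.
    by have /filter_ex[v vpsi] := Dpsi; exists v; split.
  have [|] := in_ultra_setVsetC (mods psi) uD; first by left.
  by right; split=> //; exact: over_not.
exists v => psi ppsi; apply: vP; split; first exact: pA.
by apply: pD; exists psi.
Qed.

Lemma over_instr (m n : nat) (A : set U) (phi : formula L ('I_m + 'I_n))
    (b : 'I_n -> U) : (forall c, A (b c)) -> over A (instr phi b).
Proof. by move=> Ab; apply: over_fmap => -[]. Qed.

Lemma over_instl (m n : nat) (A : set U) (phi : formula L ('I_m + 'I_n))
    (a : 'I_m -> U) : (forall c, A (a c)) -> over A (instl phi a).
Proof. by move=> Aa; apply: over_fmap => -[]. Qed.

Lemma psat_instr (m n : nat) (phi : formula L ('I_m + 'I_n))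
    (a : 'I_m -> U) (b : 'I_n -> U) : psat a (instr phi b) = sat2 phi a b.
Proof.
by rewrite /psat sat_fmap; congr (sat _ phi); apply/funext => -[].
Qed.

Lemma psat_instl (m n : nat) (phi : formula L ('I_m + 'I_n))
    (a : 'I_m -> U) (b : 'I_n -> U) : psat b (instl phi a) = sat2 phi a b.
Proof.
by rewrite /psat sat_fmap; congr (sat _ phi); apply/funext => -[].
Qed.

End OverParams.

(** * Iterated ultrafilter quantifiers *)

Section Generic.
Variables (T : Type) (D : set_system T).
Hypothesis uD : UltraFilter D.

Definition upd (s : nat -> T) (k : nat) (t : T) : nat -> T :=
  fun i => if i == k then t else s i.

(** For [D]-most [t_(k-1)], ..., for [D]-most [t_0],
    [P (t_0, ..., t_(k-1), s_k, s_(k+1), ...)]: the outermost quantifier binds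
    the last coordinate. *)
Fixpoint generic (k : nat) (P : (nat -> T) -> Prop) (s : nat -> T) : Prop :=
  if k is k'.+1 then D [set t | generic k' P (upd s k' t)] else P s.

(** This makes filter reasoning available under the whole block of quantifiers at once. *)
Lemma generic_filter (k : nat) (s : nat -> T) :
  ProperFilter [set P : set (nat -> T) | generic k P s].
Proof.
elim: k s => [|k IH] s.
  apply: Build_ProperFilter_ex; first by move=> P Ps; exists s.
  by split=> // P Q PQ Ps; exact: PQ.
apply: Build_ProperFilter_ex => [P /= DP|].
  have [t] := filter_ex DP; exact: (@filter_ex _ _ (IH (upd s k t))).
split.
- by rewrite /=; apply: filterE => t; exact: (@filterT _ _ (IH (upd s k t))).
- move=> P Q; rewrite /= => DP DQ; apply: filterS2 DP DQ => t.
  exact: (@filterI _ _ (IH (upd s k t))).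
- move=> P Q PQ; rewrite /= => DP; apply: filterS DP => t.
  exact: (@filterS _ _ (IH (upd s k t))).
Qed.

Lemma generic_not (k : nat) (P : (nat -> T) -> Prop) (s : nat -> T) :
  ~ generic k P s -> generic k (fun s' => ~ P s') s.
Proof.
elim: k s => [//|k IH] s /= /(ultraC _ uD).
by apply: filterS => t; exact: IH.
Qed.

(** The block binds only coordinates below [k], so it commutes with a change at [j]. *)
Lemma generic_upd (j k : nat) (P : (nat -> T) -> Prop) (s : nat -> T) (t : T) :
  (k <= j)%N -> generic k P (upd s j t) = generic k (fun s' => P (upd s' j t)) s.
Proof.
elim: k s => [//|k IH] s kj /=; congr D; apply/funext => t' /=.
rewrite -IH ?(ltnW kj)//; congr generic; apply/funext => i; rewrite /upd.
by case: (i =P k) => // ->; rewrite ltn_eqF.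
Qed.

(** * Patterns realised on generic tuples *)

Section Patterns.
(** In the application [R a t] is [phi(a;t)] and [Y] consists of the tuples from [M]. Then
    [compactR] is saturation over [M], and [nDR] says that no [phi(a;y)] lies in [q]. *)
Variables (X : Type) (R : X -> T -> Prop) (Y : set T).
Hypothesis DY : D Y.
Hypothesis compactR : forall S : set T, S `<=` Y ->
  (forall k (t : 'I_k -> T), (forall i, S (t i)) ->
     exists a, forall i, R a (t i)) ->
  exists a, forall t, S t -> R a t.
Hypothesis nDR : forall a, ~ D (R a).

(* A point [t] lying in [R (g s')] for generic [s'] belongs to the limit of the
   sets [R (g s')], which by compactness is contained in some [R a], hence is
   [D]-null. *)
Lemma generic_avoid (w : nat -> bool) (g : (nat -> T) -> X) :
  (forall s s', (forall i, w i -> s i = s' i) -> g s = g s') ->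
  forall k s,
  generic k (fun s' => forall i, (i < k)%N -> ~~ w i -> ~ R (g s') (s' i)) s.
Proof.
move=> gw; elim=> [//|k IH] s /=.
have [wk|wk] := boolP (w k).
  apply: filterE => t.
  apply: (@filterS _ _ (generic_filter k (upd s k t))) (IH _).
  move=> s' avoid i; rewrite ltnS leq_eqVlt => /predU1P[->|/avoid//].
  by rewrite wk.
pose S := [set t | Y t /\ generic k (fun s' => R (g s') t) s].
have nDS : ~ D S.
  move=> DS; have [|j t St|a Sa] := compactR (S := S); first by move=> t [].
    have /(@filter_ex _ _ (generic_filter k s))[s' Rs'] :
        generic k (fun s' => forall i, R (g s') (t i)) s.
      apply: (@filter_forall _ _ _ _ (generic_filter k s)) => i.
      exact: (St i).2.
    by exists (g s').
  by apply: (@nDR a); exact: filterS Sa DS.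
apply: filterS2 (DY) (iffLR (ultraC _ uD) nDS) => t Yt nSt.
(* As [k] lies outside [w], [g] does not see the value [t] placed at [k]; hence [nSt] applies to [g]
   evaluated without it. *)
have avoidk : generic k (fun s' => ~ R (g s') (s' k)) (upd s k t).
  rewrite generic_upd //; have : ~ generic k (fun s' => R (g s') t) s.
    by move=> gt; exact: nSt.
  move/generic_not; apply: (@filterS _ _ (generic_filter k s)) => s' nR.
  rewrite (gw _ s') => [|i wi]; first by rewrite /upd eqxx.
  by rewrite /upd; case: eqP wi => // ->; rewrite (negPf wk).
apply: (@filterS2 _ _ (generic_filter k (upd s k t)) _ _ _) avoidk (IH _).
by move=> s' nRk avoid i; rewrite ltnS leq_eqVlt => /predU1P[->//|/avoid].
Qed.

Lemma generic_pattern (N : nat) (s : nat -> T) (w : nat -> bool) :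
  generic N (fun s' => exists a, forall i, (i < N)%N -> R a (s' i)) s ->
  generic N (fun s' => exists a, forall i, (i < N)%N -> R a (s' i) <-> w i) s.
Proof.
move=> consR.
have [[a0]|X0] := pselect (inhabited X); last first.
  have /(@filter_ex _ _ (generic_filter N s))[s' [a _]] := consR.
  by case: X0.
(* The choice is made from the set of candidates, not from the tuple, so that tuples agreeing on [w]
   get the same witness. The default [a0] serves empty sets only. *)
pose select (P : set X) : X :=
  if pselect (exists a, P a) is left e then sval (cid e) else a0.
have selectP (P : set X) : (exists a, P a) -> P (select P).
  by rewrite /select => e; case: pselect => // e'; exact: svalP.
pose g (s' : nat -> T) :=
  select [set a | forall i, (i < N)%N -> w i -> R a (s' i)].
have gw s1 s2 : (forall i, w i -> s1 i = s2 i) -> g s1 = g s2.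
  move=> s12; congr select; apply/funext => a; apply/propext.
  by split=> H i iN wi; move: (H i iN wi); rewrite s12.
apply: (@filterS2 _ _ (generic_filter N s) _ _ _) consR (generic_avoid gw N s).
move=> s' [a Ra] avoid; exists (g s') => i iN; split=> [Rg|wi].
  by apply/negPn/negP => nwi; exact: avoid Rg.
apply: (selectP [set a | forall i, (i < N)%N -> w i -> R a (s' i)]) => //.
by exists a => j jN _; exact: Ra.
Qed.

End Patterns.
End Generic.

(** * Morley sequences of a coheir *)

Section Morley.
Variables (L : language) (U : structure L) (M : set U) (n : nat).
Variable q : set (pformula U 'I_n).
Implicit Types (bs : nat -> 'I_n -> U) (b : 'I_n -> U).

Definition base_upto bs (i : nat) : set U :=
  M `|` [set u | exists j c, (j < i)%N /\ u = bs j c].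

Definition morley bs : Prop :=
  forall i psi, q psi -> over (base_upto bs i) psi -> psat (bs i) psi.

Definition mtuple : set ('I_n -> U) := [set v | forall c, M (v c)].

Lemma complete_type_restrict (A : set U) :
  complete_type setT q -> complete_type A [set psi | q psi /\ over A psi].
Proof.
move=> [_ qcons qcompl]; split=> [psi []//|k psi psiq|psi Apsi].
  by apply: qcons => i; exact: (psiq i).1.
have [qpsi|qpsi] := qcompl psi (over_setT psi); first by left.
by right; split=> //; exact: over_not.
Qed.

(** This lets [b] itself start the Morley sequence: if [psi] failed at [b], its negation would lie
    in [q] as well, against consistency. *)
Lemma coheir_realized b : coheir M b q ->
  forall psi, q psi -> over M psi -> psat b psi.
Proof.
move=> [[_ qcons _] bq _] psi qpsi Mpsi; apply: contrapT => nbpsi.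
have qn : q (Not psi) by apply: bq; split=> //; exact: over_not.
have [|v [_ vpsi]] :=
  qcons 2 (fun i : 'I_2 => if i == ord0 then psi else Not psi).
  by move=> i; case: ifP.
by have /= := vpsi ord_max; apply; exact: (vpsi ord0).
Qed.

Lemma morley_exists (K : Type) b :
  card_lt [set: nat] [set: K] -> saturated K U -> card_lt M [set: K] ->
  coheir M b q -> exists bs, bs 0 = b /\ morley bs.
Proof.
move=> ltK satU ltM qcoh.
pose ext (l : seq ('I_n -> U)) : set U := foldr (fun v A => A `|` range v) M l.
have ltext l : card_lt (ext l) [set: K].
  elim: l => [//|v l IH]; apply: card_lt_setU => //.
  exact/finite_set_countable/finite_image/finite_finset.
have /choice[nxt nxtP] : forall l, exists v : 'I_n -> U,
    (forall psi, q psi -> over (ext l) psi -> psat v psi) /\ (l = [::] -> v = b).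
  case=> [|v l]; first by exists b; split=> //; exact: coheir_realized.
  have [qtype _ _] := qcoh.
  have [v' v'P] := satU _ (ltext (v :: l)) _ _ (complete_type_restrict _ qtype).
  by exists v'; split=> // psi qpsi Apsi; exact: v'P.
(* [pre i] lists the first [i] terms, latest first; [nxt] realises [q] over [M] and the list. *)
pose pre i := iter i (fun l => nxt l :: l) [::].
exists (fun i => nxt (pre i)); split; first exact: (nxtP [::]).2.
move=> i psi qpsi Apsi; apply: (nxtP (pre i)).1 => //.
apply: over_sub Apsi => u [Mu|[j [c [ji ->]]]].
  by elim: i => [//|i IH]; left.
elim: i ji => [//|i IH]; rewrite ltnS leq_eqVlt => /predU1P[->|/IH]; last by left.
by right; exists c.
Qed.

Section Averages.
Variables (D : set_system ('I_n -> U)) (bs : nat -> 'I_n -> U).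
Hypothesis uD : UltraFilter D.
Hypothesis DM : D mtuple.
Hypothesis qD : forall psi, q psi -> D [set v | psat v psi].
Hypothesis qtype : complete_type setT q.
Hypothesis bsP : morley bs.

(** Both sides amount to [q psi], since [q] is complete and is contained both in the type induced by
    [D] and, over this base, in the type of [bs i]. *)
Lemma psat_morley (i : nat) (psi : pformula U 'I_n) :
  over (base_upto bs i) psi -> psat (bs i) psi <-> D [set v | psat v psi].
Proof.
move=> Apsi; have [_ _ /(_ psi (over_setT psi))[qpsi|qpsi]] := qtype.
  by split=> _; [exact: qD|exact: bsP].
have nb : psat (bs i) (Not psi) by apply: bsP => //; exact: over_not.
have nD : ~ D [set v | psat v psi] by apply/(ultraC _ uD); exact: (qD qpsi).
by split=> [/nb|/nD].
Qed.

Definition ev (s : nat -> 'I_n -> U) (z : nat * 'I_n + {u : U | M u}) : U :=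
  match z with inl x => s x.1 x.2 | inr u => proj1_sig u end.

Definition mix (k : nat) (I : nat -> nat) (s : nat -> 'I_n -> U) :
    nat -> 'I_n -> U :=
  fun i => if (i < k)%N then bs (I i) else s i.

(** Induction on [k], peeling off the last term: its type over [M] and the earlier terms is given by
    [D], which matches the outermost quantifier. The remaining [s i] lie in [M], so they are
    legitimate parameters. *)
Lemma sat_morley (psi : formula L (nat * 'I_n + {u : U | M u})) (k : nat)
    (I : nat -> nat) (s : nat -> 'I_n -> U) :
  (forall i j, (i < j)%N -> (j < k)%N -> (I i < I j)%N) ->
  (forall i, mtuple (s i)) ->
  sat (ev (mix k I s)) psi <-> generic D k (fun s' => sat (ev s') psi) s.
Proof.
elim: k s => [|k IH] s Iinc Ms //=.
(* Only the tuple at index [k] stays variable; all other tuples become parameters. *)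
pose h (z : nat * 'I_n + {u : U | M u}) : 'I_n + U := match z with
  | inl x => if x.1 == k then inl x.2 else inr (mix k I s x.1 x.2)
  | inr u => inr (proj1_sig u) end.
have psat_h v : psat v (fmap h psi) = sat (ev (upd (mix k I s) k v)) psi.
  rewrite /psat sat_fmap; congr (sat _ psi).
  by apply/funext => -[[i c]|u] //=; rewrite /upd; case: (i == k).
have mixS : mix k.+1 I s = upd (mix k I s) k (bs (I k)).
  apply/funext => i; rewrite /mix /upd ltnS leq_eqVlt.
  by case: (i =P k) => [->|].
have upd_mix t : upd (mix k I s) k t = mix k I (upd s k t).
  apply/funext => i; rewrite /mix /upd.
  by case: (i =P k) => [->|//]; rewrite ltnn.
rewrite mixS -psat_h psat_morley; last first.
  apply: over_fmap => -[[i c]|[u Mu]] /=; last by left.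
  case: (i =P k) => //= /eqP ik; rewrite /mix; case: ltnP => [iltk|_].
    by right; exists (I i), c; split=> //; exact: Iinc.
  by left; exact: Ms.
have step t : mtuple t ->
    psat t (fmap h psi) <-> generic D k (fun s' => sat (ev s') psi) (upd s k t).
  move=> Mt; rewrite psat_h upd_mix; apply: IH => [i j ij jk|i].
    by apply: Iinc => //; exact: ltnW.
  by rewrite /upd; case: eqP.
(* The induction hypothesis needs [t] in [M], which holds for [D]-most [t]. *)
by split; apply: filterS2 DM => t Mt /(step t Mt).
Qed.

(** The generic side of [sat_morley] does not mention the increasing choice of indices. *)
Lemma morley_indiscernible : indiscernible M bs.
Proof.
have [t0 Mt0] := filter_ex DM.
suff tp_sub k (I J : 'I_k -> nat) :
    {homo I : i j / (i < j)%N} -> {homo J : i j / (i < j)%N} ->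
    tp M (fun ij : 'I_k * 'I_n => bs (I ij.1) ij.2) `<=`
    tp M (fun ij : 'I_k * 'I_n => bs (J ij.1) ij.2).
  by move=> k I J Iinc Jinc; apply/seteqP; split; exact: tp_sub.
move=> Iinc Jinc psi [Mpsi Ipsi]; split=> //; move: Mpsi Ipsi => [p _ <-].
(* The default 0 is harmless, as [mix k] reads its index map only below [k]. *)
pose toN (F : 'I_k -> nat) (i : nat) : nat :=
  if insub i is Some j then F j else 0.
have toNE F (i : 'I_k) : toN F i = F i by rewrite /toN valK.
have toN_inc (F : 'I_k -> nat) : {homo F : i j / (i < j)%N} ->
    forall i j, (i < j)%N -> (j < k)%N -> (toN F i < toN F j)%N.
  move=> Finc i j ij jk; have ik := ltn_trans ij jk.
  by rewrite (toNE F (Ordinal ik)) (toNE F (Ordinal jk)); exact: Finc.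
pose r (z : 'I_k * 'I_n + {u : U | M u}) : nat * 'I_n + {u : U | M u} :=
  match z with inl x => inl (val x.1, x.2) | inr u => inr u end.
have psatE F : psat (fun ij : 'I_k * 'I_n => bs (F ij.1) ij.2) (fmap
    (fun z : 'I_k * 'I_n + {u : U | M u} =>
       match z with inl x => inl x | inr c => inr (proj1_sig c) end) p)
    = sat (ev (mix k (toN F) (fun=> t0))) (fmap r p).
  rewrite /psat !sat_fmap; congr (sat _ p); apply/funext => -[[i c]|u] //=.
  by rewrite /mix ltn_ord toNE.
rewrite !psatE => /(sat_morley _ (toN_inc _ Iinc) (fun=> Mt0)) Ipsi.
exact/(sat_morley _ (toN_inc _ Jinc) (fun=> Mt0)).
Qed.

End Averages.
End Morley.

(** Definability is what allows [sat_morley] to transfer a pattern between the Morley sequence and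
    generic tuples. *)
Lemma definable_pattern (L : language) (U : structure L) (m n : nat)
    (phi : formula L ('I_m + 'I_n)) (V : Type) (y : nat -> 'I_n -> V)
    (N : nat) (w : nat -> bool) :
  definable (fun v : V -> U => exists a : 'I_m -> U,
    forall i, (i < N)%N -> sat2 phi a (v \o y i) <-> w i).
Proof.
pose h i (z : 'I_m + 'I_n) : 'I_m + V :=
  match z with inl c => inl c | inr c => inr (y i c) end.
have lit i : definable (fun v : 'I_m + V -> U => sat (v \o h i) phi <-> w i).
  have dphi := definable_sat_fmap U (h i) phi; case: (w i).
    by apply: definable_ext dphi => v; split=> [p|[_]]//; exact.
  by apply: definable_ext (definable_not dphi) => v; split=> [np|[pF _] /pF//].
have := definable_not (definable_forall_tuple
  (definable_not (definable_forall_lt N lit))).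
apply: definable_ext => v.
have hE a i : vjoin a v \o h i =
    fun z => match z with inl c => a c | inr c => (v \o y i) c end.
  by apply/funext => -[].
split=> [/existsNP[a /contrapT aP]|[a aP] /(_ a)].
  by exists a => i iN; rewrite /sat2 -hE; exact: aP.
by apply=> i iN; rewrite hE; exact: aP.
Qed.

(** * Shattered sequences *)

Lemma saturated_realizes_seq (L : language) (U : structure L) (K : Type)
    (A : set U) (k : nat) (th : nat -> pformula U 'I_k) (w : nat -> bool) :
  saturated K U -> card_lt A [set: K] -> (forall i, over A (th i)) ->
  (forall N, exists v, forall i, (i < N)%N -> psat v (th i) <-> w i) ->
  exists v, forall i, psat v (th i) <-> w i.
Proof.
move=> satU ltA Ath fin.
pose lit i := if w i then th i else Not (th i).
have psat_lit v i : psat v (lit i) <-> (psat v (th i) <-> w i).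
  rewrite /lit; case: (w i); first by split=> [p|[_]]//; exact.
  by split=> [np|[pF _] /pF//]; split=> // /np.
have [|k' psi psiP|v vP] := @saturated_realizes _ _ _ _ _ (range lit) satU ltA.
- by move=> _ [i _ <-]; rewrite /lit; case: (w i) => //; exact: over_not.
- have /choice[f fE] : forall j, exists i, lit i = psi j.
    by move=> j; have [i _] := psiP j; exists i.
  (* Finitely many literals involve only indices up to their maximum. *)
  have [v vP] := fin (\max_j f j).+1; exists v; split=> // j.
  by rewrite -fE; apply/psat_lit/vP; rewrite ltnS; exact: leq_bigmax.
- by exists v => i; apply/psat_lit/vP; exists i.
Qed.

(** The index is built from its binary digits: [w 0] is the lowest one, and halving shifts the
    others. *)
Lemma bits_realized (N : nat) (w : nat -> bool) :
  exists i, forall k, (k < N)%N -> odd (i %/ 2 ^ k) = w k.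
Proof.
elim: N w => [|N IH] w; first by exists 0.
have [i iP] := IH (w \o succn).
exists (w 0 + i.*2)%N => -[_|k kN].
  by rewrite expn0 divn1 oddD odd_double addbF oddb.
rewrite expnS divnMA -[RHS](iP k kN); congr (odd (_ %/ _)).
by rewrite divn2 halfD odd_double andbF add0n doubleK; case: (w 0).
Qed.

(* Reading off the binary digits of the index turns a shattered sequence of
   [y]-tuples into a shattered sequence of [x]-tuples. *)
Lemma shattered_not_NIP (L : language) (U : structure L) (K : Type)
    (m n : nat) (phi : formula L ('I_m + 'I_n)) (bs : nat -> 'I_n -> U) :
  card_lt [set: nat] [set: K] -> saturated K U ->
  (forall N (w : nat -> bool), exists a,
     forall i, (i < N)%N -> sat2 phi a (bs i) <-> w i) ->
  ~ NIP U phi.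
Proof.
move=> ltK satU shat; apply.
have ltcount k (f : nat -> 'I_k -> U) :
    card_lt [set u | exists i c, u = f i c] [set: K].
  apply: card_lt_countable => //.
  apply: (@sub_countable _ _ _ [set: nat * 'I_k]); last exact: countableP.
  apply: card_le_trans (card_image_le (fun x => f x.1 x.2) _).
  by apply: subset_card_le => _ [i [c ->]]; exists (i, c).
(* [a k] cuts out the indices whose binary digit of weight [2 ^ k] is 1. *)
have /choice[a aP] : forall k, exists a : 'I_m -> U,
    forall i, sat2 phi a (bs i) <-> odd (i %/ 2 ^ k).
  move=> k; have [||a aP] := saturated_realizes_seq
    (th := fun i => instr phi (bs i)) (w := fun i => odd (i %/ 2 ^ k))
    satU (ltcount _ bs).
  - by move=> i; apply: over_instr => c; exists i, c.
  - move=> N; have [a aP] := shat N (fun i => odd (i %/ 2 ^ k)).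
    by exists a => i; rewrite psat_instr; exact: aP.
  - by exists a => i; rewrite -aP psat_instr.
suff /choice[b bP] : forall J : set nat, exists b : 'I_n -> U,
    forall k, sat2 phi (a k) b <-> J k by exists a, b => k J; exact: bP.
move=> J; have [||b bP] := saturated_realizes_seq
  (th := fun k => instl phi (a k)) (w := fun k => `[< J k >])
  satU (ltcount _ a).
- by move=> k; apply: over_instl => c; exists k, c.
(* For finitely many [k] a term [bs i] suffices, the digits of [i] being prescribed by [J]. *)
- move=> N; have [i iP] := bits_realized N (fun k => `[< J k >]).
  by exists (bs i) => k kN; rewrite psat_instl aP iP.
- by exists b => k; rewrite -psat_instl bP; split=> /asboolP.
Qed.

(** * Coheirs and instances of a non-dividing NIP formula *)

Theorem theorem2p10 (L : language) (T : set (sentence L)) (K : Type)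
    (U : structure L) (M : set U) (m n : nat)
    (phi : formula L ('I_m + 'I_n)) (b : 'I_n -> U)
    (q : set (pformula U 'I_n)) :
  complete_theory T ->
  monster T K U ->
  elementary_substructure M ->
  card_lt M [set: K] ->
  NIP U phi ->
  ~ divides M phi b ->
  coheir M b q ->
  exists a : 'I_m -> U, proves q (instl phi a).
Proof.
move=> _ [_ [leK nleK] satU _] _ ltM nip ndiv qcoh.
have [qtype _ qfin] := qcoh.
have le_nat : [set: nat] #<= [set: formula L nat].
  pose f (i : nat) : formula L nat := Eq (Var L i) (Var L i).
  have finj : {in [set: nat] &, injective f} by move=> i j _ _ [].
  have := inj_card_eq finj; rewrite card_eq_sym => /card_eqPle[lef _].
  exact: card_le_trans lef (card_leT _).
have ltK : card_lt [set: nat] [set: K].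
  split; first exact: card_le_trans le_nat leK.
  by move=> KN; apply: nleK; exact: card_le_trans KN le_nat.
apply: contrapT => noa.
(* Completeness of [q] turns the assumed failure into negated instances for all [a]. *)
have qn a : q (Not (instl phi a)).
  have [_ _ /(_ _ (over_setT (instl phi a)))[qa|//]] := qtype.
  by case: noa; exists a, 1, (fun=> instl phi a); split=> // v /(_ ord0).
have [bs [bs0 bsP]] := morley_exists ltK satU ltM qcoh.
have [D [uD DM qD]] : exists D : set_system ('I_n -> U),
    [/\ UltraFilter D, D (@mtuple _ U M n)
      & forall psi, q psi -> D [set v | psat v psi]].
  (* Finite satisfiability of [q] in [M] is the finite intersection property of its solution sets
     among the tuples of [M]. *)
  have [|D [uD BD]] := @ultrafilter_extending _
    [set S | exists2 psi, q psi & S = @mtuple _ U M n `&` [set v | psat v psi]].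
    move=> k S SP.
    have /choice[psi psiP] : forall i, exists psi,
        q psi /\ S i = @mtuple _ U M n `&` [set v | psat v psi].
      by move=> i; have [psi ? ?] := SP i; exists psi.
    have [v [Mv vpsi]] := qfin _ psi (fun i => (psiP i).1).
    by exists v => i; rewrite (psiP i).2; split=> //; exact: vpsi.
  have DS psi : q psi -> D (@mtuple _ U M n `&` [set v | psat v psi]).
    by move=> qpsi; apply: BD; exists psi.
  exists D; split=> // [|psi /DS].
    have [psi qpsi] : exists psi, q psi.
      by have [_ _ /(_ Bot (over_setT _))[]] := qtype; eexists; eassumption.
    by apply: filterS (DS psi qpsi) => v [].
  by apply: filterS => v [].
have [t0 Mt0] := filter_ex DM.
have bs_consistent : consistent (range (fun i => instr phi (bs i))).
  apply: contrapT => ncons; apply: ndiv; exists bs; split=> //.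
  exact: (morley_indiscernible uD DM qD qtype bsP).
(* The pattern [w] is cut out on the Morley sequence iff it is cut out on generic tuples. *)
have patternE N (w : nat -> bool) :
    (exists a, forall i, (i < N)%N -> sat2 phi a (bs i) <-> w i)
    <-> generic D N (fun s => exists a, forall i, (i < N)%N ->
          sat2 phi a (s i) <-> w i) (fun=> t0).
  have [chi chiP] := definable_pattern U phi
    (fun i c => inl (i, c) : nat * 'I_n + {u : U | M u}) N w.
  have chiE s : sat (ev s) chi = exists a, forall i, (i < N)%N ->
      sat2 phi a (s i) <-> w i by exact/propext/chiP.
  rewrite -(funext chiE) -(sat_morley uD DM qD qtype bsP chi (I := id)) // chiE.
  by split=> -[a aP]; exists a => i iN; move: (aP i iN); rewrite /mix iN.
apply: (shattered_not_NIP ltK satU) nip => N w; apply/patternE.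
apply: (@generic_pattern _ _ uD _ (sat2 phi) (@mtuple _ U M n)) => //.
- move=> S SM Sfin; have [| |a aP] := @saturated_realizes _ _ _ _ _
    [set psi | exists2 t, S t & psi = instr phi t] satU ltM.
  + by move=> _ [t St ->]; apply: over_instr; exact: SM.
  + move=> k psi psiP.
    have /choice[t tP] : forall i, exists t, S t /\ psi i = instr phi t.
      by move=> i; have [t ? ?] := psiP i; exists t.
    have [a aP] := Sfin _ t (fun i => (tP i).1).
    by exists a; split=> // i; rewrite (tP i).2 psat_instr.
  + by exists a => t St; rewrite -psat_instr; apply: aP; exists t.
- move=> a; apply/(ultraC _ uD); apply: filterS (qD _ (qn a)) => v.
  by rewrite /= -psat_instl.
(* Non-dividing enters here: consistency of the instances along [bs] is the constantly true pattern,
   which passes to generic tuples. *)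
- have /patternE : exists a, forall i, (i < N)%N ->
      sat2 phi a (bs i) <-> xpredT i.
    have [|a [_ aP]] := bs_consistent N (fun i => instr phi (bs i)).
      by move=> i; exists i.
    exists a => i iN; split=> // _.
    by rewrite -psat_instr; exact: (aP (Ordinal iN)).
  apply: (@filterS _ _ (generic_filter uD N _)) => s [a aP].
  by exists a => i iN; exact/aP.
Qed.
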